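(* Let $L/\mathbb R(x)$ be a finite algebraic extension of degree $d$, and let $K$ be a nonzero differentiable function on an interval $J\subset\mathbb R$ such that $\rho:=K'/K\in L$. Let $v_1,\dots,v_d$ be a basis of $L$ over $\mathbb R(x)$, $\mathbf v=(v_1,\dots,v_d)^{T}$, and let $q=\sum_{j=0}^{b}q_jx^j\in\mathbb R[x]$ and $Q=\sum_{j=0}^{w}Q_jx^j$ with $Q_j\in M_d(\mathbb R)$ be as in the context. Then for every integer $n\ge0$ the vector moments $\mathbf I_n(x)=\int x^n\mathbf v(x)K(x)\,dx$ satisfy the finite block recurrence $$\sum_{j=0}^{b}nq_j\mathbf I_{n+j-1}+\sum_{j=0}^{w}Q_j\mathbf I_{n+j}=x^nq(x)\mathbf v(x)K(x)+\mathbf C ,$$ where $\mathbf C$ is a constant vector. Consequently, after ordering the relations according to their largest moment index, one obtains a finite block-band system with blocks of size $d\times d$ (the relation for $n$ involves, with $d\times d$ matrix coefficients, only the vector moments $\mathbf I_l$ with $n-1\le l\le n+\max\{b-1,w\}$).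
   Context: Elements of $L$ are regarded as functions on $J$, compatibly with the field operations and with differentiation, where $d/dx$ on $L$ is the unique extension of $d/dx$ on $\mathbb R(x)$; $J$ is assumed to be such that all functions involved are defined on it. There are matrices $M,R\in M_d(\mathbb R(x))$ with $\mathbf v'=M\mathbf v$ and $\rho\mathbf v=R\mathbf v$; put $H=M+R$, so that $(\mathbf vK)'=H\mathbf vK$. Let $q\in\mathbb R[x]$ be a nonzero polynomial clearing the denominators of the entries of $H$, and set $G=qH\in M_d(\mathbb R[x])$ and $Q=q'I_d+G$. Integrals are antiderivatives (taken componentwise), and identities hold up to additive constants. For $n=0$ the terms with coefficient $n$ are zero (in particular $\mathbf I_{-1}$ does not occur). *)

(* Defs.v *)
From HB Require Import structures.
From mathcomp Require Import all_boot all_order all_algebra all_field.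
From mathcomp Require Import all_classical all_reals all_analysis.
Import numFieldNormedType.Exports.
Import Order.TTheory GRing.Theory Num.Theory.

Set Implicit Arguments.
Unset Strict Implicit.
Unset Printing Implicit Defensive.

Local Open Scope classical_set_scope.
Local Open Scope ring_scope.

Notation ratfun R := {fraction {poly R}}.

(* The difference quotient is taken inside J, so that the derivative is
   one-sided at an endpoint belonging to J. *)
Definition has_deriv_on (R : realType) (J : set R) (f : R -> R) (t l : R)
    : Prop :=
  (f s - f t) / (s - t) @[s --> within J t^'] --> l.

Definition antiderivative_on (R : realType) (J : set R) (F f : R -> R) : Prop :=
  forall t, J t -> has_deriv_on J F t (f t).

(* Since L is algebraic over R(x) and the characteristic is 0, exactly one map
   D satisfies this. *)
Record extends_ddx (R : realType) (L : fieldExtType (ratfun R)) (D : L -> L)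
    : Prop := ExtendsDdx {
  ddx_add : forall f g, D (f + g) = D f + D g;
  ddx_mul : forall f g, D (f * g) = D f * g + f * D g;
  ddx_ratfun : forall p r : {poly R}, r != 0 ->
    D (tofrac p / tofrac r)%:A =
    (tofrac (p^`() * r - p * r^`()) / tofrac (r ^+ 2))%:A
}.

(* Not every element of L is a function on all of J (think of poles), so S
   collects elements that are, and ev f is the function attached to f \in S; its
   values for f \notin S or outside J are irrelevant.  Neither f^-1 nor D f is
   assumed to be defined on J when f is. *)
Record functions_on (R : realType) (L : fieldExtType (ratfun R)) (D : L -> L)
    (J : set R) (S : {pred L}) (ev : L -> R -> R) : Prop := FunctionsOn {
  fun_subring : GRing.subring_closed S;
  fun_poly_in : forall p : {poly R}, (tofrac p)%:A \in S;
  fun_poly : forall (p : {poly R}) t, J t -> ev (tofrac p)%:A t = p.[t];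
  fun_add : forall f g t, f \in S -> g \in S -> J t ->
    ev (f + g) t = ev f t + ev g t;
  fun_opp : forall f t, f \in S -> J t -> ev (- f) t = - ev f t;
  fun_mul : forall f g t, f \in S -> g \in S -> J t ->
    ev (f * g) t = ev f t * ev g t;
  fun_inv : forall f t, f \in S -> f^-1 \in S -> J t ->
    ev f^-1 t = (ev f t)^-1;
  fun_deriv : forall f t, f \in S -> D f \in S -> J t ->
    has_deriv_on J (ev f) t (ev (D f) t)
}.

(* For n = j = 0 the index n + j - 1 is truncated to 0, but the coefficient
   n%:R vanishes, so no term with index -1 is being misrepresented. *)
Definition recurrence_lhs (R : realType) (d b w : nat) (qc : nat -> R)
    (Qc : nat -> 'M[R]_d) (n : nat) (X : nat -> 'cV[R]_d) : 'cV[R]_d :=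
  \sum_(j < b.+1) (n%:R * qc j) *: X (n + j - 1)%N
  + \sum_(j < w.+1) Qc j *m X (n + j)%N.

(* Main.v *)
(* The function x^n q v K has derivative
   (n x^(n-1) q + x^n q') v K + x^n q H v K = (n x^(n-1) q + x^n Q) v K.
   Expanding q and Q in powers of x, this is also the derivative of the left-hand
   side of the recurrence, and two functions with the same derivative on an
   interval differ by a constant. *)

Require Import Defs.
From HB Require Import structures.
From mathcomp Require Import all_boot all_order all_algebra all_field.
From mathcomp Require Import zify ring.
From mathcomp Require Import all_classical all_reals all_analysis.
Import numFieldNormedType.Exports.
Import Order.TTheory GRing.Theory Num.Theory.

Set Implicit Arguments.
Unset Strict Implicit.
Unset Printing Implicit Defensive.

Local Open Scope classical_set_scope.
Local Open Scope ring_scope.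

(** * Calculus of derivatives relative to a set [J], up to the uniqueness of antiderivatives *)

Section DerivativeOn.
Variables (R : realType) (J : set R).
Implicit Types (f g : R -> R) (t : R).

Lemma has_deriv_on_cvg f t l :
  has_deriv_on J f t l -> f s @[s --> within J t^'] --> f t.
Proof.
move=> df.
have st0 : (s - t) @[s --> within J t^'] --> 0.
  rewrite -(subrr t); apply: cvgB; last exact: cvg_cst.
  exact: cvg_trans (cvg_within _) (cvg_within _).
(* Away from [t] this expression equals [f s], so its limit is the one sought. *)
have : (f s - f t) / (s - t) * (s - t) + f t @[s --> within J t^'] --> l * 0 + f t.
  by apply: cvgD; [exact: cvgM | exact: cvg_cst].
rewrite mulr0 add0r; apply: cvg_trans; apply: near_eq_cvg.
rewrite near_withinE; near=> s => _.
have st : s - t != 0 by rewrite subr_eq0; near: s; exact: nbhs_dnbhs_neq.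
by rewrite divfK// subrK.
Unshelve. all: by end_near. Qed.

Lemma has_deriv_on_continuous f t l :
  has_deriv_on J f t l -> f s @[s --> within J (nbhs t)] --> f t.
Proof.
move=> /has_deriv_on_cvg df U Ut; have /= dfU := df U Ut.
move: (dfU); rewrite /= !nbhs_filterE /within/= => dfU'.
rewrite !near_simpl in dfU' *.
rewrite near_withinE /dnbhs in dfU' *.
apply: filterS dfU' => s st Js.
have [->|/st] := eqVneq s t; first exact: nbhs_singleton.
exact.
Qed.

Lemma has_deriv_on_ext f g t l : J t -> {in J, f =1 g} ->
  has_deriv_on J f t l -> has_deriv_on J g t l.
Proof.
move=> Jt fg; apply: cvg_trans; apply: near_eq_cvg.
rewrite near_withinE; near=> s => Js.
by rewrite !fg ?inE.
Unshelve. all: by end_near. Qed.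

Lemma has_deriv_on_cst a t : has_deriv_on J (cst a) t 0.
Proof.
rewrite /has_deriv_on; under eq_cvg do rewrite subrr mul0r.
exact: cvg_cst.
Qed.

Lemma has_deriv_onD f g t l m : has_deriv_on J f t l -> has_deriv_on J g t m ->
  has_deriv_on J (fun s => f s + g s) t (l + m).
Proof.
move=> df dg; rewrite /has_deriv_on.
have E s : (f s + g s - (f t + g t)) / (s - t)
    = (f s - f t) / (s - t) + (g s - g t) / (s - t).
  by rewrite opprD addrACA mulrDl.
under eq_cvg do rewrite E.
exact: cvgD.
Qed.

Lemma has_deriv_onM f g t l m : has_deriv_on J f t l -> has_deriv_on J g t m ->
  has_deriv_on J (fun s => f s * g s) t (l * g t + f t * m).
Proof.
move=> df dg; rewrite /has_deriv_on addrC.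
have E s : (f s * g s - f t * g t) / (s - t)
    = f s * ((g s - g t) / (s - t)) + (f s - f t) / (s - t) * g t.
  by ring.
under eq_cvg do rewrite E.
apply: cvgD; apply: cvgM => //; last exact: cvg_cst.
exact: has_deriv_on_cvg df.
Qed.

Lemma has_deriv_onZ a f t l : has_deriv_on J f t l ->
  has_deriv_on J (fun s => a * f s) t (a * l).
Proof.
move=> /(has_deriv_onM (has_deriv_on_cst a t)).
by rewrite mul0r add0r.
Qed.

Lemma has_deriv_on_sum (I : Type) (r : seq I) (f : I -> R -> R) t (l : I -> R) :
  (forall i, has_deriv_on J (f i) t (l i)) ->
  has_deriv_on J (fun s => \sum_(i <- r) f i s) t (\sum_(i <- r) l i).
Proof.
move=> df; elim: r => [|i r IHr].
  rewrite big_nil; under eq_fun do rewrite big_nil.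
  exact: has_deriv_on_cst.
rewrite big_cons; under eq_fun do rewrite big_cons.
exact: has_deriv_onD.
Qed.

(** Near a point interior to [J] the restriction to [J] disappears, which gives access to the mean
    value theorem for ordinary derivatives. *)
Lemma has_deriv_on_is_derive f t l : nbhs t J ->
  has_deriv_on J f t l -> is_derive t 1 f l.
Proof.
move=> Jt df.
have dft : (f s - f t) / (s - t) @[s --> t^'] --> l.
  apply: cvg_trans df; apply: cvg_app => U; rewrite /within/= !nbhs_filterE.
  by move=> /= UJ; near=> s; apply: (near UJ s) => //; near: s; exact: nbhs_dnbhs.
(* Change of variable [s = h + t]. *)
have dfh : h^-1 *: ((f \o shift t) (h *: 1) - f t) @[h --> 0^'] --> l.
  apply/cvgrPdist_le => e e0.
  move/cvgrPdist_le : dft => /(_ _ e0).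
  rewrite !near_withinE /= => /nbhs_ballP[r /= r0 rP].
  apply/nbhs_ballP; exists r => //= h hr h0.
  have := rP (h + t); rewrite addrK [_^-1 *: _]mulrC /shift/= [h *: 1]mulr1; apply.
    by move: hr; rewrite /ball/= sub0r normrN opprD addrCA subrr addr0 normrN.
  by rewrite -subr_eq0 addrK.
apply: DeriveDef; first by apply/cvg_ex; exists l.
exact: cvg_lim dfh.
Unshelve. all: by end_near. Qed.

(** Mean value theorem on a segment contained in [J]: its inner points have ordinary derivative 0,
    and at its ends the one-sided derivative gives continuity. *)
Lemma has_deriv_on_const f : is_interval J ->
  (forall t, J t -> has_deriv_on J f t 0) ->
  forall s t, J s -> J t -> f s = f t.
Proof.
move=> itvJ df.
suff H s t : s < t -> J s -> J t -> f s = f t.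
  move=> s t Js Jt; have [st|ts|->//] := ltgtP s t; first exact: H.
  by apply/esym; exact: H.
move=> st Js Jt.
have subJ : `[s, t] `<=` J.
  move=> x; rewrite /= in_itv/= => sxt; exact: (itvJ s t).
suff [c _] : exists2 c, c \in `]s, t[ & f t - f s = 0 * (t - s).
  by rewrite mul0r => /eqP; rewrite subr_eq0 => /eqP.
apply: (@MVT R f (cst 0)) => // [x xst|].
  apply: has_deriv_on_is_derive.
    apply: filterS (near_in_itvoo xst) => y /= yst; apply: subJ => /=.
    exact: subset_itv_oo_cc.
  by apply: df; apply: subJ; exact: subset_itv_oo_cc.
apply/subspace_continuousP => x /subJ Jx.
apply: cvg_trans (has_deriv_on_continuous (df x Jx)).
apply: cvg_app; exact: within_subset.
Qed.

Lemma eq_antiderivative_col (d : nat) (F E : R -> 'cV[R]_d) : is_interval J ->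
  (forall i, exists2 h : R -> R,
    antiderivative_on J (fun t => F t i 0) h &
    antiderivative_on J (fun t => E t i 0) h) ->
  exists C, forall t, J t -> F t = E t + C.
Proof.
move=> itvJ FE.
have [[t0 Jt0]|J0] := pselect (J !=set0); last first.
  by exists 0 => t Jt; case: J0; exists t.
(* The constant is read off at a base point [t0]; for empty [J] any constant served. *)
exists (F t0 - E t0) => t Jt; apply/colP => i; rewrite !mxE.
have [h Fh Eh] := FE i.
pose f u := F u i 0 + -1 * E u i 0.
suff : f t = f t0 by rewrite /f !mulN1r => <-; rewrite addrC subrK.
apply: has_deriv_on_const => // u Ju.
have := has_deriv_onD (Fh u Ju) (has_deriv_onZ (a := -1) (Eh u Ju)).
by rewrite mulN1r subrr.
Qed.

End DerivativeOn.

(** * The differential system satisfied by the basis, first inside [L], then as functions on [J] *)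

Section DifferentialSystem.
Variables (R : realType) (L : fieldExtType (ratfun R)) (D : L -> L).
Hypothesis hD : extends_ddx D.

Definition of_poly (p : {poly R}) : L := (tofrac p)%:A.

HB.instance Definition _ :=
  GRing.RMorphism.copy of_poly (in_alg L \o @tofrac {poly R}).

Lemma ddx_poly (p : {poly R}) : D (of_poly p) = of_poly p^`().
Proof.
have := ddx_ratfun hD p (oner_neq0 _).
by rewrite expr1n !(rmorph1 (@tofrac _)) !divr1 derivC mulr0 subr0 mulr1.
Qed.

Variables (d : nat) (v : d.-tuple L) (rho : L) (M Rm : 'M[ratfun R]_d).
Hypothesis hM : \col_i D (tnth v i) = map_mx (in_alg L) M *m \col_i tnth v i.
Hypothesis hRm :
  rho *: \col_i tnth v i = map_mx (in_alg L) Rm *m \col_i tnth v i.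
Variables (q : {poly R}) (G : 'M[{poly R}]_d).
Hypothesis hG : map_mx (@tofrac {poly R}) G = tofrac q *: (M + Rm).

(** This is (v K)' = H v K divided by [K] and multiplied by [q], so that the coefficients become the
    polynomial entries of G = q H. *)
Lemma twisted_deriv_basis i :
  of_poly q * (D (tnth v i) + rho * tnth v i) =
  \sum_k of_poly (G i k) * tnth v k.
Proof.
have /matrixP/(_ i 0) := hM; rewrite !mxE => ->.
have /matrixP/(_ i 0) := hRm; rewrite !mxE => ->.
rewrite -big_split mulr_sumr; apply: eq_bigr => k _; rewrite !mxE /= -mulrDl.
have /matrixP/(_ i k) := hG; rewrite !mxE => GG.
by rewrite /of_poly GG -scalerDl mulrA -[_%:A * _%:A]scalerAl mul1r scalerA.
Qed.

(** The left side is the derivative of x^n q v_i K divided by [K]. Differentiating [q] produces q',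
    which joins [G] to form Q = q' I_d + G. *)
Lemma twisted_deriv_monomial n i :
  D (of_poly ('X^n * q) * tnth v i) + of_poly ('X^n * q) * tnth v i * rho =
  of_poly ('X^n^`() * q) * tnth v i
  + \sum_k of_poly ('X^n * (q^`()%:M + G) i k) * tnth v k.
Proof.
rewrite (ddx_mul hD) ddx_poly derivM rmorphD mulrDl -!addrA; congr (_ + _).
under eq_bigr do rewrite !mxE mulrDr rmorphD mulrDl.
rewrite big_split /= (bigD1 i)//= eqxx big1 ?addr0 => [|k /negPf]; last first.
  by rewrite eq_sym => ->; rewrite mulr0 raddf0 mul0r.
congr (_ + _).
under eq_bigr do rewrite rmorphM -mulrA.
rewrite -mulr_sumr -twisted_deriv_basis mulrA -rmorphM -mulrA.
by rewrite -mulrDr [rho * _]mulrC.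
Qed.

Variables (J : set R) (S : {pred L}) (ev : L -> R -> R).
Hypothesis hev : functions_on D J S ev.

Lemma of_poly_fun (p : {poly R}) : of_poly p \in S.
Proof. exact: (fun_poly_in hev). Qed.

Lemma mul_fun f g : f \in S -> g \in S -> f * g \in S.
Proof. by have [_ _] := fun_subring hev; apply. Qed.

Lemma add_fun f g : f \in S -> g \in S -> f + g \in S.
Proof. exact: (GRing.zmod_closedD (GRing.subring_closedB (fun_subring hev))).2. Qed.

Lemma ev_poly_mul (p : {poly R}) f t : f \in S -> J t ->
  ev (of_poly p * f) t = p.[t] * ev f t.
Proof.
by move=> fS Jt; rewrite (fun_mul hev) ?of_poly_fun// (fun_poly hev).
Qed.

(** Membership in [S] is carried through the induction together with the value, because [ev] is
    assumed additive only on [S]. *)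
Lemma ev_poly_comb (I : Type) (r : seq I) (p : I -> {poly R}) (f : I -> L) t :
  (forall i, f i \in S) -> J t ->
  \sum_(i <- r) of_poly (p i) * f i \in S /\
  ev (\sum_(i <- r) of_poly (p i) * f i) t = \sum_(i <- r) (p i).[t] * ev (f i) t.
Proof.
move=> fS Jt; elim: r => [|i r [IHS IHr]].
  by rewrite !big_nil -(rmorph0 of_poly) of_poly_fun (fun_poly hev)// horner0.
rewrite !big_cons add_fun ?mul_fun ?of_poly_fun//; split=> //.
by rewrite (fun_add hev) ?mul_fun ?of_poly_fun// ev_poly_mul// IHr.
Qed.

Variables (K K' : R -> R).
Hypothesis hK' : forall t, J t -> has_deriv_on J K t (K' t).
Hypothesis hK : forall t, J t -> K t != 0.
Hypothesis hrhoS : rho \in S.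
Hypothesis hrho : forall t, J t -> K' t / K t = ev rho t.
Hypothesis hvS : forall i, tnth v i \in S.
Hypothesis hDvS : forall i, D (tnth v i) \in S.

Lemma has_deriv_on_boundary n i t : J t ->
  has_deriv_on J (fun u => u ^+ n * q.[u] * K u * ev (tnth v i) u) t
   ((('X^n^`() * q).[t] * ev (tnth v i) t
     + \sum_k ('X^n * (q^`()%:M + G) i k).[t] * ev (tnth v k) t) * K t).
Proof.
move=> Jt; set f := of_poly ('X^n * q) * tnth v i.
have fS : f \in S by rewrite mul_fun ?of_poly_fun.
(* [S] is not assumed stable under [D]; the product rule reduces the claim to [tnth v i] and its
   derivative. *)
have DfS : D f \in S.
  by rewrite (ddx_mul hD) ddx_poly add_fun ?mul_fun ?of_poly_fun.
apply: (@has_deriv_on_ext _ _ (fun u => ev f u * K u)) => // [u|].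
  rewrite inE => Ju.
  by rewrite ev_poly_mul// hornerM hornerXn mulrAC.
have [QS <-] := @ev_poly_comb _ (index_enum 'I_d)
  (fun k => 'X^n * (q^`()%:M + G) i k) (tnth v) t hvS Jt.
rewrite -ev_poly_mul// -(fun_add hev) ?mul_fun ?of_poly_fun//.
rewrite -twisted_deriv_monomial (fun_add hev) ?mul_fun ?of_poly_fun//.
(* Replacing rho by K'/K and cancelling [K] leaves f' K + f K', the product rule for f K. *)
rewrite [ev (_ * rho) t](fun_mul hev)// -hrho// mulrDl -mulrA divfK ?hK//.
apply: has_deriv_onM; last exact: hK'.
exact: (fun_deriv hev).
Qed.

End DifferentialSystem.

(** * Regrouping the recurrence by moment index: the block-band form *)

Lemma band_mulmx_sum (R : pzRingType) (d c k m p : nat) (f : nat -> nat)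
    (B : nat -> 'M[R]_d) (X : nat -> 'M[R]_(d, c)) :
  (forall j, (j < k)%N -> B j != 0 -> (m <= f j < p)%N) ->
  \sum_(m <= l < p) (\sum_(j < k | f j == l) B j) *m X l =
  \sum_(j < k) B j *m X (f j).
Proof.
move=> fB; under eq_bigr do rewrite mulmx_suml big_mkcond/=.
rewrite exchange_big/=; apply: eq_bigr => j _.
(* A zero [B j] contributes to neither side; otherwise [f j] lies in the summation range and is met
   there exactly once. *)
have [->|/(fB j (ltn_ord j)) fj] := eqVneq (B j) 0.
  by rewrite mul0mx big1// => l _; case: ifP; rewrite ?mul0mx.
rewrite (bigD1_seq (f j)) ?iota_uniq ?mem_index_iota//= eqxx.
by rewrite big1 ?addr0// => l; rewrite eq_sym => /negPf ->.
Qed.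

Section BandForm.
Variables (R : realType) (d b w : nat) (qc : nat -> R) (Qc : nat -> 'M[R]_d).
(** For [b = 0] the truncated [b.-1] is 0 instead of -1, which leaves the maximum with [w]
    unchanged. *)
Let s := maxn b.-1 w.

Definition band_coef (n l : nat) : 'M[R]_d :=
  \sum_(j < b.+1 | (n + j - 1 == l)%N) (n%:R * qc j)%:M
  + \sum_(j < w.+1 | (n + j == l)%N) Qc j.

Let qc_band n j : (j < b.+1)%N -> (n%:R * qc j)%:M != 0 :> 'M[R]_d ->
  (n.-1 <= n + j - 1 <= n + s)%N.
Proof.
case: n => [_|n jb _]; first by rewrite mul0r raddf0 eqxx.
rewrite /s; lia.
Qed.

Let Qc_band n j : (j < w.+1)%N -> (n.-1 <= n + j <= n + s)%N.
Proof. rewrite /s; lia. Qed.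

Lemma band_coef_eq0 n l : ~~ (n.-1 <= l <= n + s)%N -> band_coef n l = 0.
Proof.
move=> nl; rewrite /band_coef !big1 ?addr0// => j /eqP jl.
  by move: nl; rewrite -jl (Qc_band n (ltn_ord j)).
apply/eqP; apply: contraNT nl; rewrite -jl; exact: qc_band.
Qed.

Lemma recurrence_lhs_band n (X : nat -> 'cV[R]_d) :
  recurrence_lhs b w qc Qc n X = \sum_(n.-1 <= l < (n + s).+1) band_coef n l *m X l.
Proof.
rewrite /recurrence_lhs /band_coef.
under [RHS]eq_bigr do rewrite mulmxDl.
rewrite big_split/=; congr (_ + _).
  rewrite (@band_mulmx_sum _ _ _ _ _ _ (fun j => n + j - 1)%N
    (fun j => (n%:R * qc j)%:M)) => [|j jb /(qc_band jb)//].
  by apply: eq_bigr => j _; rewrite mul_scalar_mx.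
rewrite (@band_mulmx_sum _ _ _ _ _ _ (addn n) Qc)// => j jw _.
exact: Qc_band.
Qed.

(** The relations with n < N reach indices at most N - 1 + s, so [N + s] block columns contain every
    moment involved. *)
Lemma recurrence_lhs_block N (X : nat -> 'cV[R]_d) :
  \mxblock_(n < N, l < N + s) band_coef n l *m \mxcol_(l < N + s) X l =
  \mxcol_(n < N) recurrence_lhs b w qc Qc n X.
Proof.
rewrite mul_mxblock_mxrow; apply: eq_mxcol => n.
rewrite recurrence_lhs_band -(big_mkord xpredT (fun l => band_coef n l *m X l)).
have nN := ltn_ord n.
(* The full row is cut at both ends of the band; the two outer pieces vanish. *)
rewrite (@big_cat_nat _ _ _ n.-1)//=; last by lia.
rewrite (@big_cat_nat _ _ _ (n + s).+1 n.-1)//=; try lia.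
rewrite big_nat_cond big1 ?add0r => [|l]; last first.
  by move=> /andP[ln _]; rewrite band_coef_eq0 ?mul0mx//; lia.
rewrite [X in _ + X]big_nat_cond [X in _ + X]big1 ?addr0// => l.
by move=> /andP[ln _]; rewrite band_coef_eq0 ?mul0mx//; lia.
Qed.

End BandForm.

(** * The moment recurrence and the resulting block-band system *)

Theorem theorem4p2 (R : realType)
  (* the extension L / R(x), of degree d, with its derivation and a basis v *)
  (L : fieldExtType (ratfun R)) (d : nat) (hd : \dim {:L} = d)
  (D : L -> L) (hD : extends_ddx D)
  (v : d.-tuple L) (hv : basis_of {:L} v)
  (* elements of L as functions on the interval J *)
  (J : set R) (hJ : is_interval J)
  (S : {pred L}) (ev : L -> R -> R) (hev : functions_on D J S ev)
  (* K, its derivative K', and rho = K' / K *)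
  (K K' : R -> R) (hK' : forall t, J t -> has_deriv_on J K t (K' t))
  (hK : forall t, J t -> K t != 0)
  (rho : L) (hrhoS : rho \in S)
  (hrho : forall t, J t -> K' t / K t = ev rho t)
  (hvS : forall i : 'I_d, tnth v i \in S)
  (hDvS : forall i : 'I_d, D (tnth v i) \in S)
  (* v' = M v and rho v = Rm v *)
  (M Rm : 'M[ratfun R]_d)
  (hM : \col_i D (tnth v i) = map_mx (in_alg L) M *m \col_i tnth v i)
  (hRm : rho *: \col_i tnth v i = map_mx (in_alg L) Rm *m \col_i tnth v i)
  (* q clears the denominators of H = M + Rm, and G = q H *)
  (q : {poly R}) (hq0 : q != 0)
  (G : 'M[{poly R}]_d)
  (hG : map_mx (@tofrac {poly R}) G = tofrac q *: (M + Rm))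
  (* coefficients of q and of Q = q' I_d + G *)
  (b w : nat) (qc : nat -> R) (Qc : nat -> 'M[R]_d)
  (hq : q = \sum_(j < b.+1) qc j *: 'X^j)
  (hQ : q^`()%:M + G = \sum_(j < w.+1) 'X^j *: map_mx polyC (Qc j)) :
  let s := maxn b.-1 w in
  let is_moments (I : nat -> R -> 'cV[R]_d) :=
    forall n (i : 'I_d),
      antiderivative_on J (fun t => I n t i 0)
        (fun t => t ^+ n * ev (tnth v i) t * K t) in
  let rhs n t : 'cV[R]_d :=
    (t ^+ n * q.[t] * K t) *: \col_i ev (tnth v i) t in
  (forall I, is_moments I -> forall n, exists C : 'cV[R]_d,
     forall t, J t ->
       recurrence_lhs b w qc Qc n (fun l => I l t) = rhs n t + C)
  /\
  (exists A : nat -> nat -> 'M[R]_d,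
     [/\ forall n l, A n l != 0 -> (n.-1 <= l <= n + s)%N,
         forall n (X : nat -> 'cV[R]_d),
           recurrence_lhs b w qc Qc n X =
           \sum_(n.-1 <= l < (n + s).+1) A n l *m X l
       & forall I, is_moments I -> exists C : nat -> 'cV[R]_d,
           forall N t, J t ->
             \mxblock_(n < N, l < N + s) A n l *m \mxcol_(l < N + s) I l t =
             \mxcol_(n < N) (rhs n t + C n)]).
Proof.
move=> s is_moments rhs.
have recI I : is_moments I -> forall n, exists C : 'cV[R]_d, forall t, J t ->
    recurrence_lhs b w qc Qc n (fun l => I l t) = rhs n t + C.
  move=> hI n; apply: eq_antiderivative_col => // i.
  (* The common derivative of both sides in component [i]: each moment on the left is replaced by
     its integrand. *)
  pose lhs' t := \sum_(j < b.+1) (n%:R * qc j) * (t ^+ (n + j - 1) * ev (tnth v i) t * K t)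
    + \sum_(j < w.+1) \sum_k Qc j i k * (t ^+ (n + j) * ev (tnth v k) t * K t).
  exists lhs' => t Jt.
    apply: (@has_deriv_on_ext _ _ (fun u =>
      \sum_(j < b.+1) (n%:R * qc j) * I (n + j - 1)%N u i 0
      + \sum_(j < w.+1) \sum_k Qc j i k * I (n + j)%N u k 0)) => // [u _|].
      rewrite /recurrence_lhs !mxE !summxE; congr (_ + _).
        by apply: eq_bigr => j _; rewrite !mxE.
      by apply: eq_bigr => j _; rewrite !mxE.
    apply: has_deriv_onD; apply: has_deriv_on_sum => j.
      by apply: has_deriv_onZ; exact: hI.
    apply: has_deriv_on_sum => k; apply: has_deriv_onZ; exact: hI.
  apply: (@has_deriv_on_ext _ _
    (fun u => u ^+ n * q.[u] * K u * ev (tnth v i) u)) => // [u _|].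
    by rewrite !mxE.
  suff -> : lhs' t = ('X^n^`() * q).[t] * ev (tnth v i) t * K t
    + (\sum_k ('X^n * (q^`()%:M + G) i k).[t] * ev (tnth v k) t) * K t.
    rewrite -mulrDl.
    exact: (has_deriv_on_boundary hD hM hRm hG hev hK' hK hrhoS hrho hvS hDvS).
  rewrite {}/lhs'; congr (_ + _).
    rewrite hornerM hq horner_sum mulr_sumr !mulr_suml.
    apply: eq_bigr => j _.
    rewrite hornerZ hornerXn derivXn hornerMn hornerXn.
    (* For [n = 0] both sides vanish, whatever the truncated exponent; for a successor the exponent
       is exactly [n + j]. *)
    case: n => [|n]; first by rewrite !mulr0n !mul0r.
    by rewrite addSn subn1 /= exprD; ring.
  (* With the component [k] outermost, the inner sum is the expansion of the entry (i, k) of Q in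
     powers of x. *)
  rewrite exchange_big mulr_suml; apply: eq_bigr => k _ /=.
  rewrite hQ summxE hornerM horner_sum hornerXn mulr_sumr !mulr_suml.
  apply: eq_bigr => j _.
  by rewrite !mxE hornerM hornerXn hornerC exprD; ring.
split=> //; exists (band_coef b w qc Qc); split.
- by move=> n l; apply: contraNT => /band_coef_eq0 ->.
- exact: recurrence_lhs_band.
(* The constants of all relations are chosen at once, so a single sequence serves every truncation
   size [N]. *)
- move=> I /recI /choice[C hC]; exists C => N t Jt.
  rewrite (recurrence_lhs_block _ _ _ _ _ (fun l => I l t)).
  by apply: eq_mxcol => n; exact: hC.
Qed.
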